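(* There exist absolute constants $C>0$, $D>0$ and $\ell_0$ such that the following holds. Let $\ell$ and $u\ge \ell$ be integers, let $n:=2^\ell$, and let $S\subseteq \mathbb{F}_2^u$ have size $n$. Let $h:\mathbb{F}_2^u\to\mathbb{F}_2^\ell$ be a uniformly random linear map. Then for every real $R>1$ satisfying \[ R\,\ell^{1-1/R}\ge D\ln \ell \] and every $\ell\ge \ell_0$, \[ \Pr_h\left[\mathsf M(S,h)\ge R\frac{\ell}{\log\ell}\right]\le C\,\frac{(\ln\ell)^2}{R^2\,\ell^{2-2/R}}. \]
   Context: All logarithms $\log$ are base $2$; $\ln$ is the natural logarithm. For a linear map $h:\mathbb{F}_2^u\to\mathbb{F}_2^\ell$ and $S\subseteq\mathbb{F}_2^u$, the load of $y\in\mathbb{F}_2^\ell$ is $\operatorname{load}_h(y):=|h^{-1}(y)\cap S|$, and the maximum load is $\mathsf M(S,h):=\max_{y\in\mathbb{F}_2^\ell}\operatorname{load}_h(y)$. A uniformly random linear map $\mathbb{F}_2^u\to\mathbb{F}_2^\ell$ is one chosen uniformly among all linear maps (equivalently, given by a uniformly random $\ell\times u$ binary matrix). *)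

(* Defs.v *)
From mathcomp Require Import all_boot all_order all_algebra.
From Stdlib Require Import Reals.

Set Implicit Arguments.
Unset Strict Implicit.
Unset Printing Implicit Defensive.

(* F_2^u is represented by column vectors 'cV['F_2]_u; a linear map
   F_2^u -> F_2^l is given by an l x u matrix A acting as x |-> A *m x. *)

Definition load (l u : nat) (S : {set 'cV['F_2]_u}) (A : 'M['F_2]_(l, u))
  (y : 'cV['F_2]_l) : nat :=
  #|[set x in S | mulmx A x == y]|.

Definition maxload (l u : nat) (S : {set 'cV['F_2]_u}) (A : 'M['F_2]_(l, u)) : nat :=
  (\max_(y : 'cV['F_2]_l) load S A y)%N.

Definition prob_lin (l u : nat) (E : pred 'M['F_2]_(l, u)) : R :=
  (INR #|[set A : 'M['F_2]_(l, u) | E A]| / INR #|{: 'M['F_2]_(l, u)}|)%R.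

Definition log2 (x : R) : R := (ln x / ln 2)%R.

Definition Rleb (a b : R) : bool := if Rle_dec a b then true else false.

(* Main.v *)
(* For [b > 1] let the potential of [h : F_2^u -> F_2^m] be the mean of
   [b ^ load] over the codomain.  Dropping one output bit of a uniform [h]
   after adding to each other coordinate a random multiple of it leaves the
   result uniform, and at most squares the potential in expectation.  The
   potential is always at least [1 + a] with [a = (b - 1) |S| / 2^m], with
   equality when [h] is injective on [S].  Hence the expectation of the
   concave truncation [ramp] of the potential, with a threshold [E] that gets
   squared at each step, grows by at most [a^2 / (E^2 - 1 - 2a)] when [m]
   decreases by one.  Starting from [m] arbitrarily large, where [h] is injective
   on [S] with probability close to 1, these errors sum to [O((b / t)^2)] for
   [E = exp t] at [m = l].  A maximum load [t] makes the potential at least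
   [b^t / 2^l], which is [exp t] for [b = e * l^(1/R)] and
   [t = R l / log l]. *)
Require Import Defs.
From Stdlib Require Import Reals Lra.
From mathcomp Require Import all_boot all_order all_algebra.

Set Implicit Arguments.
Unset Strict Implicit.
Unset Printing Implicit Defensive.

Open Scope R_scope.

(** * Real identities for the threshold and the final bound *)

Lemma ln_gt0 (x : R) : 1 < x -> 0 < ln x.
Proof. by move=> x1; rewrite -ln_1; apply: ln_increasing; lra. Qed.

Lemma exp1_div_ln2_sqr_gt0 : 0 < 4 * (exp 1 / ln 2) ^ 2.
Proof.
apply: Rmult_lt_0_compat; first by lra.
by apply: pow_lt; apply: Rdiv_lt_0_compat; [apply: exp_pos | apply: ln_gt0; lra].
Qed.

Lemma threshold_gt0 (x r : R) : 1 < x -> 0 < r -> 0 < r * x / log2 x.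
Proof.
move=> x1 r0; apply: Rdiv_lt_0_compat; first by apply: Rmult_lt_0_compat; lra.
by apply: Rdiv_lt_0_compat; apply: ln_gt0; lra.
Qed.

(** For [x = l] this says that [b = exp (1 + ln l / r)] and the threshold [t] satisfy
    [b^t = exp t * 2^l]. *)
Lemma threshold_mul_ln (x r : R) :
  1 < x -> 0 < r -> r * x / log2 x * (ln x / r) = x * ln 2.
Proof.
move=> x1 r0; have := ln_gt0 x1; have ln2 : 0 < ln 2 by apply: ln_gt0; lra.
by move=> lnx; rewrite /log2; field; lra.
Qed.

Lemma Rpower_sub_double (x r : R) :
  0 < x -> Rpower x (2 - 2 / r) = (x / exp (ln x / r)) ^ 2.
Proof.
move=> x0; rewrite -{2}(exp_ln x) // /Rdiv -exp_Ropp -exp_plus /= Rmult_1_r.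
rewrite -exp_plus /Rpower; congr exp; rewrite /Rdiv; ring.
Qed.

(** Puts the target bound in the form [4 * (b / t) ^ 2] that the potential argument yields, with
    [b = e * x^(1/r)] and [t] the load threshold. *)
Lemma tail_boundE (x r : R) : 1 < x -> 0 < r ->
  4 * (exp 1 / ln 2) ^ 2 * ln x ^ 2 / (r ^ 2 * Rpower x (2 - 2 / r))
  = 4 * (exp (1 + ln x / r) / (r * x / log2 x)) ^ 2.
Proof.
move=> x1 r0; have := ln_gt0 x1; have ln2 : 0 < ln 2 by apply: ln_gt0; lra.
move=> lnx; have := exp_pos (ln x / r) => e0.
rewrite Rpower_sub_double ?exp_plus /log2; last by lra.
by field; repeat split; lra.
Qed.

Close Scope R_scope.

From mathcomp Require Import Rstruct ring lra.
(* [Rstruct] shadows [Rleb]. *)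
Import Defs.
Import Order.TTheory GRing.Theory Num.Theory.
Open Scope ring_scope.

(** * Averages over finite types *)

Definition avg (K : realFieldType) (T : finType) (F : T -> K) : K :=
  (\sum_t F t) / #|T|%:R.

Lemma ler_avg (K : realFieldType) (T : finType) (F G : T -> K) :
  (forall t, F t <= G t) -> avg F <= avg G.
Proof. by move=> FG; rewrite ler_wpM2r ?invr_ge0 ?ler0n ?ler_sum. Qed.

Lemma eq_avg (K : realFieldType) (T : finType) (F G : T -> K) :
  (forall t, F t = G t) -> avg F = avg G.
Proof. by move=> FG; rewrite /avg; under eq_bigr do rewrite FG. Qed.

Lemma avg_const (K : realFieldType) (T : finType) (c : K) :
  (0 < #|T|)%N -> avg (fun _ : T => c) = c.
Proof.
move=> T0; have T1 : #|T|%:R != 0 :> K by rewrite pnatr_eq0 -lt0n.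
by apply: (canLR (mulfK T1)); rewrite sumr_const mulr_natr.
Qed.

Lemma avgD (K : realFieldType) (T : finType) (F G : T -> K) :
  avg (fun t => F t + G t) = avg F + avg G.
Proof. by rewrite /avg big_split mulrDl. Qed.

Lemma avgZ (K : realFieldType) (T : finType) (c : K) (F : T -> K) :
  avg (fun t => c * F t) = c * avg F.
Proof. by rewrite /avg -mulr_sumr mulrA. Qed.

Lemma exchange_avg (K : realFieldType) (T U : finType) (F : T -> U -> K) :
  avg (fun t => avg (F t)) = avg (fun u => avg (F^~ u)).
Proof. by rewrite /avg -!mulr_suml exchange_big /= mulrAC. Qed.

Lemma reindex_avg (K : realFieldType) (T U : finType) (h : U -> T) (F : T -> K) :
  bijective h -> avg F = avg (F \o h).
Proof.
move=> bh; rewrite /avg (bij_eq_card bh) (reindex h) //.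
exact: onW_bij.
Qed.

Lemma avg_pair (K : realFieldType) (T U : finType) (F : T -> U -> K) :
  avg (fun p : T * U => F p.1 p.2) = avg (fun t => avg (F t)).
Proof.
by rewrite /avg -(pair_bigA _ F) /= -mulr_suml card_prod natrM invfM mulrA mulrAC.
Qed.

Lemma avg_col_mx (K : realFieldType) (F : finType) (m1 m2 n : nat)
    (G : 'M[F]_(m1 + m2, n) -> K) :
  avg G = avg (fun A1 => avg (fun A2 => G (col_mx A1 A2))).
Proof.
rewrite (@reindex_avg _ _ ('M[F]_(m1, n) * 'M[F]_(m2, n))%type
  (fun p => col_mx p.1 p.2)).
  exact: (avg_pair (fun A1 A2 => G (col_mx A1 A2))).
exists (fun A => (usubmx A, dsubmx A)) => [[A1 A2]|A] /=.
  by rewrite col_mxKu col_mxKd.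
by rewrite vsubmxK.
Qed.

Lemma avg_addl (K : realFieldType) (V : finZmodType) (v : V) (F : V -> K) :
  avg (fun x => F (v + x)) = avg F.
Proof.
rewrite [RHS](@reindex_avg _ _ _ (fun x => v + x)) //.
by exists (fun x => - v + x) => x; rewrite ?addKr ?addNKr.
Qed.

(* Adding to the last [m] rows of a uniform matrix a random multiple of the
   first row keeps them uniform. *)
Lemma avg_fold_row (K : realFieldType) (F : finNzRingType) (m n : nat)
    (G : 'M[F]_(m, n) -> K) :
  avg G = avg (fun A : 'M[F]_(1 + m, n) =>
            avg (fun w : 'cV_m => G (dsubmx A + w *m usubmx A))).
Proof.
rewrite [RHS]avg_col_mx; apply/esym.
have F0 k p : (0 < #|{: 'M[F]_(k, p)}|)%N by apply/card_gt0P; exists 0.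
rewrite -[RHS](avg_const _ (F0 1%N n)); apply: eq_avg => r.
rewrite exchange_avg -[RHS](avg_const _ (F0 m 1%N)); apply: eq_avg => w.
(* Once [r] and [w] are fixed, the fold is a translation of the remaining rows. *)
rewrite -[RHS](avg_addl (w *m r)); apply: eq_avg => A.
by rewrite col_mxKd col_mxKu addrC.
Qed.

(** * Matrices over the two-element field *)

Lemma card_F2_mx (m n : nat) : #|{: 'M['F_2]_(m, n)}| = expn 2 (m * n).
Proof. by rewrite card_mx card_Fp. Qed.

Lemma card_F2_cV (m : nat) : #|{: 'cV['F_2]_m}| = expn 2 m.
Proof. by rewrite card_F2_mx muln1. Qed.

Lemma card_F2_mx_gt0 (m n : nat) : (0 < #|{: 'M['F_2]_(m, n)}|)%N.
Proof. by rewrite card_F2_mx expn_gt0. Qed.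

Lemma F2_cV1_eq (c : 'cV['F_2]_1) : (c != 0) = (c == 1%:M).
Proof.
rewrite [c]mx11_scalar; move: (c 0 0) => {c} x.
have inj : injective (@scalar_mx 'F_2 1).
  by move=> y z /matrixP /(_ 0 0); rewrite !mxE eqxx.
rewrite -[0](raddf0 (@scalar_mx 'F_2 1)) !(inj_eq inj).
by case: x => [[|[|[]]]].
Qed.

Lemma avg_F2_cV1 (K : realFieldType) (F : 'cV['F_2]_1 -> K) :
  avg F = (F 0 + F 1%:M) / 2.
Proof.
rewrite /avg card_F2_mx (bigD1 0) //= (bigD1 1%:M) /=; last by rewrite F2_cV1_eq.
by rewrite big1 ?addr0 // => c; rewrite F2_cV1_eq => /andP[->].
Qed.

(** * The potential and its behaviour under folding *)

Definition potential (K : realFieldType) (b : K) (m u : nat)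
    (S : {set 'cV['F_2]_u}) (A : 'M['F_2]_(m, u)) : K :=
  avg (fun y => b ^+ load S A y).

(** Split [S] by the first output bit: where it is 0 the fold leaves the other bits alone, where it
    is 1 it shifts them by [w]. *)
Lemma load_fold_row (m u : nat) (S : {set 'cV['F_2]_u})
    (A : 'M['F_2]_(1 + m, u)) (w y : 'cV['F_2]_m) :
  load S (dsubmx A + w *m usubmx A) y =
  (load S A (col_mx (0 : 'cV_1) y) + load S A (col_mx (1%:M : 'cV_1) (y - w)))%N.
Proof.
rewrite /load -{3 4}(vsubmxK A).
set A0 := usubmx A; set A' := dsubmx A.
rewrite -(cardsID [set x | A0 *m x == 0]); congr (_ + _)%N; apply: eq_card => x.
  rewrite !inE mul_col_mx mulmxDl -mulmxA.
  have [-> | A0x] := eqVneq (A0 *m x) 0.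
    rewrite mulmx0 addr0 andbT; congr (_ && _).
    by apply/eqP/eqP => [->|/eq_col_mx[]].
  rewrite andbF; apply/esym/negbTE; rewrite negb_and orbC.
  by apply/orP; left; apply/eqP => /eq_col_mx[A0x0]; rewrite A0x0 eqxx in A0x.
rewrite !inE mul_col_mx mulmxDl -mulmxA F2_cV1_eq.
have [-> | A0x] := eqVneq (A0 *m x) 1%:M.
  rewrite mulmx1 /=; congr (_ && _).
  apply/eqP/eqP => [<-|/eq_col_mx[_ ->]]; last by rewrite subrK.
  by rewrite addrK.
apply/esym/negbTE; rewrite negb_and orbC.
by apply/orP; left; apply/eqP => /eq_col_mx[A0x1]; rewrite A0x1 eqxx in A0x.
Qed.

(* The left side is the product of the means of [b ^+ load] over the two
   halves of the codomain of [A]: conclude by AM-GM. *)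
Lemma avg_potential_fold_row (K : realFieldType) (b : K) (m u : nat)
    (S : {set 'cV['F_2]_u}) (A : 'M['F_2]_(1 + m, u)) :
  avg (fun w : 'cV_m => potential b S (dsubmx A + w *m usubmx A))
  <= potential b S A ^+ 2.
Proof.
pose P (c : 'cV['F_2]_1) := avg (fun y : 'cV_m => b ^+ load S A (col_mx c y)).
have -> : potential b S A = (P 0 + P 1%:M) / 2.
  by rewrite /potential avg_col_mx avg_F2_cV1.
suff -> : avg (fun w : 'cV_m => potential b S (dsubmx A + w *m usubmx A))
          = P 0 * P 1%:M.
  by have := sqr_ge0 (P 0 - P 1%:M); lra.
rewrite exchange_avg.
transitivity (avg (fun y : 'cV_m => P 1%:M * b ^+ load S A (col_mx (0 : 'cV_1) y))).
  apply: eq_avg => y.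
  under eq_avg => w do rewrite load_fold_row exprD.
  rewrite avgZ mulrC; congr (_ * _).
  (* For fixed [y] the point [y - w] is uniform, so the second factor averages to [P 1%:M] whatever
     [y] is. *)
  rewrite /P [RHS](@reindex_avg _ _ _ (fun w => y - w)) //.
  by exists (fun w => y - w) => w; rewrite subKr.
by rewrite avgZ mulrC.
Qed.

Lemma sum_load (m u : nat) (S : {set 'cV['F_2]_u}) (A : 'M['F_2]_(m, u)) :
  (\sum_y load S A y)%N = #|S|.
Proof.
rewrite -sum1_card (partition_big (mulmx A) predT) //=.
apply: eq_bigr => y _; rewrite /load -sum1_card.
by apply: eq_bigl => x; rewrite inE.
Qed.

Lemma avg_affine_load (K : realFieldType) (c : K) (m u : nat)
    (S : {set 'cV['F_2]_u}) (A : 'M['F_2]_(m, u)) :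
  avg (fun y => 1 + c * (load S A y)%:R) = 1 + c * #|S|%:R / 2 ^+ m.
Proof.
rewrite avgD avg_const ?card_F2_mx_gt0 // avgZ /avg -natr_sum sum_load.
by rewrite card_F2_cV natrX mulrA.
Qed.

Lemma bernoulli (K : realFieldType) (b : K) (n : nat) :
  1 <= b -> 1 + (b - 1) * n%:R <= b ^+ n.
Proof.
move=> b1; elim: n => [|n IH]; first by rewrite mulr0 addr0.
rewrite exprS; have := ler_wpM2l (le_trans ler01 b1) IH; apply: le_trans.
rewrite -natr1; have := mulr_ge0 (ler0n K n) (sqr_ge0 (b - 1)); lra.
Qed.

(** Bernoulli's inequality at each [y]; the linear terms average exactly because the loads sum to
    [#|S|]. *)
Lemma potential_ge (K : realFieldType) (b : K) (m u : nat)
    (S : {set 'cV['F_2]_u}) (A : 'M['F_2]_(m, u)) :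
  1 <= b -> 1 + (b - 1) * #|S|%:R / 2 ^+ m <= potential b S A.
Proof.
move=> b1; rewrite -(avg_affine_load _ _ A) ler_avg // => y.
exact: bernoulli.
Qed.

(** All loads are 0 or 1, the two exponents at which Bernoulli's inequality is an equality. *)
Lemma potential_inj (K : realFieldType) (b : K) (m u : nat)
    (S : {set 'cV['F_2]_u}) (A : 'M['F_2]_(m, u)) :
  {in S &, injective (mulmx A)} ->
  potential b S A = 1 + (b - 1) * #|S|%:R / 2 ^+ m.
Proof.
move=> injA; rewrite -(avg_affine_load _ _ A); apply: eq_avg => y.
have : (load S A y <= 1)%N.
  apply/card_le1_eqP => x z; rewrite !inE => /andP[xS /eqP Ax] /andP[zS /eqP Az].
  by apply: injA; rewrite // Ax Az.
case: (load S A y) => [|[|]] // _; first by rewrite mulr0 addr0.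
by rewrite mulr1 addrC subrK.
Qed.

(** * Injectivity of a random linear map on [S] *)

Lemma avg_sum (K : realFieldType) (T I : finType) (P : pred I) (F : I -> T -> K) :
  avg (fun t => \sum_(i | P i) F i t) = \sum_(i | P i) avg (F i).
Proof. by rewrite /avg exchange_big /= mulr_suml. Qed.

(** Pick a row [e] with [e *m z = 1]. Translating [A] by [w *m e] shifts [A *m z] by [w], so
    [A *m z] is uniform. *)
Lemma avg_mulmx_eq0 (K : realFieldType) (m u : nat) (z : 'cV['F_2]_u) :
  z != 0 -> avg (fun A : 'M_(m, u) => (A *m z == 0)%:R) = 2 ^- m :> K.
Proof.
move=> z0; have [i zi] : exists i, z i 0 != 0.
  apply/existsP; apply: contraNT z0; rewrite negb_exists => /forallP z0.
  by apply/eqP/matrixP => i j; rewrite ord1 mxE; apply/eqP; rewrite -[_ == _]negbK.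
pose e : 'rV['F_2]_u := delta_mx 0 i.
have ez : e *m z = 1%:M.
  apply/eqP; rewrite -F2_cV1_eq; apply: contraNneq zi => /matrixP /(_ 0 0).
  by rewrite -rowE !mxE => ->.
rewrite -[LHS](avg_const _ (card_F2_mx_gt0 m 1)).
transitivity (avg (fun w : 'cV['F_2]_m =>
    avg (fun A : 'M_(m, u) => (w + A *m z == 0)%:R : K))).
  apply: eq_avg => w; rewrite -[LHS](avg_addl (w *m e)).
  by apply: eq_avg => A; rewrite mulmxDl -mulmxA ez mulmx1.
rewrite exchange_avg -[RHS](avg_const _ (card_F2_mx_gt0 m u)).
apply: eq_avg => A; rewrite /avg card_F2_cV natrX (bigD1 (- (A *m z))) //=.
rewrite addNr eqxx big1 ?addr0 ?mul1r // => w; rewrite -addr_eq0.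
by move/negbTE => ->.
Qed.

(** Union bound over ordered pairs of distinct points of [S]; a collision means that [A] kills their
    difference. *)
Lemma avg_not_inj_le (K : realFieldType) (m u : nat) (S : {set 'cV['F_2]_u}) :
  avg (fun A : 'M_(m, u) => (~~ dinjectiveb (mulmx A) S)%:R)
  <= #|S|%:R ^+ 2 / 2 ^+ m :> K.
Proof.
pose P := [pred p : 'cV['F_2]_u * 'cV['F_2]_u |
            [&& p.1 \in S, p.2 \in S & p.1 != p.2]].
apply: (@le_trans _ _ (avg (fun A : 'M_(m, u) =>
    \sum_(p | P p) (A *m (p.1 - p.2) == 0)%:R))).
  apply: ler_avg => A.
  have [|/dinjectivePn[x xS [y]]] := boolP (dinjectiveb (mulmx A) S).
    by move=> _; rewrite sumr_ge0.
  rewrite !inE => /andP[yx yS] Axy.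
  rewrite (bigD1 (x, y)) /=; last by rewrite xS yS eq_sym.
  by rewrite mulmxBr Axy subrr eqxx lerDl sumr_ge0.
rewrite avg_sum (eq_bigr (fun=> 2 ^- m)); last first.
  by move=> p /and3P[_ _ pq]; rewrite avg_mulmx_eq0 // subr_eq0.
rewrite sumr_const -[_ *+ _]mulr_natl ler_wpM2r ?invr_ge0 ?exprn_ge0 ?ler0n //.
rewrite -natrX ler_nat -[(_ ^ 2)%N]cardsX.
by apply: subset_leq_card; apply/subsetP => p; rewrite !inE => /and3P[-> ->].
Qed.

(** * The truncated potential and its growth in one step *)

(** Jensen's inequality for the concave truncation at 1. *)
Lemma avg_min_le (K : realFieldType) (T : finType) (F : T -> K) :
  (0 < #|T|)%N -> avg (fun t => Num.min 1 (F t)) <= Num.min 1 (avg F).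
Proof.
move=> T0; rewrite le_min; apply/andP; split.
  by rewrite -[leRHS](avg_const _ T0) ler_avg // => t; rewrite ge_min lexx.
by rewrite ler_avg // => t; rewrite ge_min lexx orbT.
Qed.

(* Interpolates between 0 at [1 + a], the least possible value of the
   potential, and 1 at [E]. *)
Definition ramp (K : realFieldType) (a E x : K) : K :=
  Num.min 1 ((x - 1 - a) / (E - 1 - a)).

(* For [x <= E] the convex function [x ^+ 2] lies below its chord over
   [1 + a, E]. *)
Lemma ramp_sqr_le (K : realFieldType) (a E x : K) :
  0 <= a -> 1 + a < E -> 1 + a <= x ->
  ramp (2 * a) (E ^+ 2) (x ^+ 2) <= ramp a E x + a ^+ 2 / (E ^+ 2 - 1 - 2 * a).
Proof.
move=> a0 aE ax; rewrite /ramp.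
have D0 : 0 < E - 1 - a by lra.
have D1 : 0 < E ^+ 2 - 1 - 2 * a by nra.
have err0 : 0 <= a ^+ 2 / (E ^+ 2 - 1 - 2 * a) by rewrite divr_ge0 ?sqr_ge0 ?ltW.
have [Ex|xE] := leP E x.
  rewrite [X in _ <= X + _]min_l; last by rewrite ler_pdivlMr //; lra.
  by rewrite ge_min lerDl err0.
rewrite [X in _ <= X + _]min_r; last by rewrite ler_pdivrMr //; lra.
rewrite ge_min; apply/orP; right.
rewrite -lerBlDr -mulrBl ler_pdivrMr // mulrAC ler_pdivlMr //.
(* After cancelling [x - 1 - a], use [x <= E] and [(E + 1 + a) * (E - 1 - a) = E ^+ 2 - (1 + a) ^+ 2
   <= E ^+ 2 - 1 - 2 * a]. *)
have -> : x ^+ 2 - 1 - 2 * a - a ^+ 2 = (x - 1 - a) * (x + 1 + a) by ring.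
rewrite -mulrA ler_wpM2l //; first by lra.
nra.
Qed.

(** Realize the smaller matrix as a fold of the larger one. For each [A], Jensen moves the mean over
    [w] inside the ramp, the potential there is at most squared, and the chord bound applies.
    Halving the codomain turns [a] into [2 * a]. *)
Lemma avg_ramp_step (K : realFieldType) (b a E : K) (m u : nat)
    (S : {set 'cV['F_2]_u}) :
  1 <= b -> a = (b - 1) * #|S|%:R / 2 ^+ m.+1 -> 1 + a < E ->
  avg (fun A : 'M_(m, u) => ramp (2 * a) (E ^+ 2) (potential b S A))
  <= avg (fun A : 'M_(m.+1, u) => ramp a E (potential b S A))
     + a ^+ 2 / (E ^+ 2 - 1 - 2 * a).
Proof.
move=> b1 aE aE1.
have a0 : 0 <= a.
  by rewrite aE divr_ge0 ?exprn_ge0 ?ler0n // mulr_ge0 ?ler0n ?subr_ge0.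
have D1 : 0 < E ^+ 2 - 1 - 2 * a by nra.
rewrite avg_fold_row -[X in _ <= _ + X](avg_const _ (card_F2_mx_gt0 m.+1 u)) -avgD.
apply: ler_avg => A; apply: le_trans (avg_min_le _ (card_F2_mx_gt0 m 1)) _.
apply: le_trans (ramp_sqr_le a0 aE1 (_ : _ <= potential b S A)); last first.
  by rewrite aE potential_ge.
rewrite /ramp le_min2 //.
under eq_avg do rewrite mulrC.
rewrite avgZ !avgD !avg_const ?card_F2_mx_gt0 // mulrC.
apply: ler_wpM2r; first by rewrite invr_ge0 ltW.
by rewrite !lerD2r avg_potential_fold_row.
Qed.
Lemma ramp_ge0 (K : realFieldType) (a E x : K) :
  1 + a < E -> 1 + a <= x -> 0 <= ramp a E x.
Proof. by move=> aE ax; rewrite le_min ler01 divr_ge0; lra. Qed.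

Lemma ramp_eq1 (K : realFieldType) (a E x : K) :
  1 + a < E -> E <= x -> ramp a E x = 1.
Proof.
move=> aE Ex; rewrite /ramp min_l // ler_pdivlMr; last by lra.
by lra.
Qed.

(** The ramp vanishes at [1 + a], the potential of an injective map, and never exceeds 1
    otherwise. *)
Lemma avg_ramp_le (K : realFieldType) (b a E : K) (m u : nat)
    (S : {set 'cV['F_2]_u}) :
  a = (b - 1) * #|S|%:R / 2 ^+ m ->
  avg (fun A : 'M_(m, u) => ramp a E (potential b S A)) <= #|S|%:R ^+ 2 / 2 ^+ m.
Proof.
move=> aE; apply: le_trans (avg_not_inj_le _ _ S); apply: ler_avg => A.
case: dinjectiveP => [injA|_]; last by rewrite ge_min lexx.
rewrite (potential_inj _ injA) -aE /ramp (_ : 1 + a - 1 - a = 0); last by ring.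
by rewrite mul0r ge_min lexx orbT.
Qed.

(* [4 * r ^+ 2 * s / (1 + s)] is chosen so that its increment from [s] to
   [2 * s] absorbs the error of [ramp_sqr_le]. *)
Lemma ramp_error_le (K : realFieldType) (r s E : K) :
  0 <= r -> r <= 1 / 2 -> 0 < s -> (1 + s / 2) ^+ 2 <= E ->
  (r * s) ^+ 2 / (E ^+ 2 - 1 - 2 * (r * s)) + 4 * r ^+ 2 * (s / (1 + s))
  <= 4 * r ^+ 2 * ((2 * s) / (1 + 2 * s)).
Proof.
move=> r0 r2 s0 sE.
have sE2 : (1 + s / 2) ^+ 4 <= E ^+ 2.
  have sq0 := sqr_ge0 (1 + s / 2).
  by rewrite (exprM _ 2 2) lerXn2r ?nnegrE // (le_trans sq0).
have rs : r * s <= s / 2 by nra.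
have s2 : 0 < s ^+ 2 by rewrite exprn_gt0.
have s3 : 0 < s ^+ 3 by rewrite exprn_gt0.
have s4 : 0 < s ^+ 4 by rewrite exprn_gt0.
(* Expanding [(1 + s / 2) ^+ 4] and using [2 * r * s <= s], the right side is at least
   [4 s + 6 s^2 + 2 s^3]; the left side is [s + 3 s^2 + 2 s^3]. *)
have D : s * ((1 + 2 * s) * (1 + s)) <= 4 * (E ^+ 2 - 1 - 2 * (r * s)) by lra.
have D0 : 0 < E ^+ 2 - 1 - 2 * (r * s) by lra.
rewrite -lerBrDr.
have -> : 4 * r ^+ 2 * ((2 * s) / (1 + 2 * s)) - 4 * r ^+ 2 * (s / (1 + s))
          = 4 * (r ^+ 2 * s) / ((1 + 2 * s) * (1 + s)).
  by field; apply/andP; split; apply: lt0r_neq0; lra.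
have P0 : 0 < (1 + 2 * s) * (1 + s) by rewrite mulr_gt0; lra.
rewrite ler_pdivlMr // mulrAC ler_pdivrMr //.
have -> : (r * s) ^+ 2 * ((1 + 2 * s) * (1 + s))
          = r ^+ 2 * s * (s * ((1 + 2 * s) * (1 + s))) by ring.
have -> : 4 * (r ^+ 2 * s) * (E ^+ 2 - 1 - 2 * (r * s))
          = r ^+ 2 * s * (4 * (E ^+ 2 - 1 - 2 * (r * s))) by ring.
by rewrite ler_wpM2l // mulr_ge0 ?sqr_ge0 ?ltW.
Qed.

(** * Summing the errors over all codomain dimensions *)

Lemma expR_ge1D (s : R) : 1 + s <= exp s.
Proof. by apply/RleP; apply: exp_ineq1_le. Qed.

Lemma expR_ge_sqr (s : R) : 0 <= s -> (1 + s / 2) ^+ 2 <= exp s.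
Proof.
move=> s0; pose h := s / 2; rewrite -/h.
have le_exp : 1 + h <= exp h by exact: expR_ge1D.
have -> : exp s = exp h ^+ 2 by rewrite expRX -mulr_natr /h divfK ?pnatr_eq0.
have h0 : 0 <= h by rewrite divr_ge0.
by rewrite lerXn2r // nnegrE; lra.
Qed.

Lemma expR_gt (s : R) : 0 < s -> 1 + s < exp s.
Proof. by move=> s0; have := expR_ge_sqr (ltW s0); nra. Qed.

(** Telescoping from dimension [m + k] down to [m]. Each decrease doubles [s], hence squares the
    threshold [exp s], while [a / s = r] stays fixed. Each error is at most an increment of [c], and
    [c m <= 4 * r ^+ 2] since [s / (1 + s) <= 1]. *)
Lemma avg_ramp_bound (b t : R) (m u : nat) (S : {set 'cV['F_2]_u}) :
  1 <= b -> 0 < t -> (b - 1) / t <= 1 / 2 -> (0 < #|S|)%N ->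
  avg (fun A : 'M_(m, u) =>
    ramp ((b - 1) * #|S|%:R / 2 ^+ m) (exp (t * #|S|%:R / 2 ^+ m)%R)
      (potential b S A)) <= 4 * ((b - 1) / t) ^+ 2.
Proof.
move=> b1 t0; set r := (b - 1) / t => r2 S0.
pose s k := t * #|S|%:R / 2 ^+ k.
pose a k := (b - 1) * #|S|%:R / 2 ^+ k.
pose V k := avg (fun A : 'M_(k, u) => ramp (a k) (exp (s k)) (potential b S A)).
pose c k := 4 * r ^+ 2 * (s k / (1 + s k)).
have p2 k : 0 < 2 ^+ k :> R by rewrite exprn_gt0.
have r0 : 0 <= r by rewrite divr_ge0 ?subr_ge0 // ltW.
have s0 k : 0 < s k by rewrite divr_gt0 ?mulr_gt0 ?ltr0n.
have halfa k : a k = 2 * a k.+1.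
  by rewrite /a exprS; field; rewrite lt0r_neq0.
have halfs k : s k = 2 * s k.+1.
  by rewrite /s exprS; field; rewrite lt0r_neq0.
have aE k : a k = r * s k.
  by rewrite /a /s /r; field; rewrite !lt0r_neq0.
have step k : V k <= V k.+1 + (c k - c k.+1).
  have aS : 1 + a k.+1 < exp (s k.+1).
    by apply: le_lt_trans (expR_gt (s0 _)); rewrite aE; have := s0 k.+1; nra.
  have E2 : exp (s k) = exp (s k.+1) ^+ 2 by rewrite expRX -mulr_natl -halfs.
  rewrite /V halfa E2; apply: le_trans (avg_ramp_step b1 (erefl (a k.+1)) aS) _.
  rewrite lerD2l lerBrDr /c (halfs k) aE.
  exact: ramp_error_le (expR_ge_sqr (ltW (s0 _))).
have steps k : V m <= V (m + k)%N + (c m - c (m + k)%N).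
  elim: k => [|k IH]; first by rewrite addn0 subrr addr0.
  by apply: (le_trans IH); rewrite addnS; have := step (m + k)%N; lra.
have cm : c m <= 4 * r ^+ 2.
  apply: ler_piMr; first by rewrite mulr_ge0 ?sqr_ge0.
  by rewrite ler_pdivrMr; have := s0 m; lra.
have c0 k : 0 <= c k.
  apply: mulr_ge0; first by rewrite mulr_ge0 ?sqr_ge0.
  by apply: divr_ge0; have := s0 k; lra.
apply/ler_addgt0Pr => e e0; rewrite -/(V m).
(* Choose [k] so large that the non-injectivity bound at dimension [m + k] is below [e]. *)
pose x := #|S|%:R ^+ 2 / e.
have [k xk] : exists k, x < 2 ^+ k.
  exists (Num.bound x); apply: (@lt_trans _ _ (Num.bound x)%:R).
    by rewrite archi_boundP // divr_ge0 ?sqr_ge0 // ltW.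
  by rewrite -natrX ltr_nat ltn_expl.
have small : V (m + k)%N <= e.
  apply: le_trans (avg_ramp_le _ (erefl _)) _.
  rewrite ler_pdivrMr // mulrC -ler_pdivrMr // -/x (le_trans (ltW xk)) //.
  by rewrite ler_weXn2l ?leq_addl //; lra.
have := steps k; have := c0 (m + k)%N; lra.
Qed.

(** With [#|S| = 2 ^ m] the ramp runs from [b] to [exp t], and it dominates the indicator of the
    event. *)
Lemma avg_potential_tail (b t : R) (m u : nat) (S : {set 'cV['F_2]_u}) :
  1 <= b -> 0 < t -> #|S| = expn 2 m ->
  avg (fun A : 'M_(m, u) => (exp t <= potential b S A)%R%:R) <= 4 * (b / t) ^+ 2.
Proof.
move=> b1 t0 Sm; have bt0 : 0 <= b / t by rewrite divr_ge0; lra.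
have p2 : 2 ^+ m != 0 :> R by rewrite expf_neq0 // pnatr_eq0.
(* When [b / t >= 1 / 2] the claimed bound is at least 1. *)
have [bt|bt] := leP (1 / 2) (b / t).
  apply: (@le_trans _ _ 1); last by nra.
  rewrite -[leRHS](avg_const _ (card_F2_mx_gt0 m u)) ler_avg // => A.
  by rewrite lern1 leq_b1.
have rb : (b - 1) / t <= b / t by rewrite ler_wpM2r ?invr_ge0; lra.
have r0 : 0 <= (b - 1) / t by rewrite divr_ge0; lra.
have r2 : (b - 1) / t <= 1 / 2 by lra.
have := @avg_ramp_bound b t m u S b1 t0 r2; rewrite Sm expn_gt0 natrX.
rewrite !mulfK // => /(_ isT) bound.
apply: (@le_trans _ _ (4 * ((b - 1) / t) ^+ 2)); last by nra.
apply: le_trans bound; apply: ler_avg => A.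
have bE : 1 + (b - 1) < exp t.
  apply: le_lt_trans (expR_gt t0); rewrite lerD2l.
  by move: r2; rewrite ler_pdivrMr //; lra.
case: (leP (exp t)) => [|_]; first by move/(ramp_eq1 bE) => ->.
apply: ramp_ge0 => //; have := potential_ge S A b1.
by rewrite Sm natrX mulfK.
Qed.

(** * From the potential to the maximum load *)

Lemma prob_linE (l u : nat) (P : pred 'M['F_2]_(l, u)) :
  prob_lin P = avg (fun A => (P A)%:R).
Proof.
rewrite /prob_lin /avg RdivE !INRE; congr (_ / _).
rewrite -sum1_card natr_sum big_mkcond; apply: eq_bigr => A _.
by rewrite inE; case: (P A).
Qed.

Lemma maxload_potential_le (b : R) (m u : nat) (S : {set 'cV['F_2]_u})
    (A : 'M['F_2]_(m, u)) :
  0 <= b -> b ^+ maxload S A / 2 ^+ m <= potential b S A.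
Proof.
move=> b0; rewrite /maxload.
have [y ->] := bigop.eq_bigmax (load S A) (card_F2_mx_gt0 m 1).
rewrite /potential /avg card_F2_cV natrX ler_wpM2r ?invr_ge0 ?exprn_ge0 //.
by rewrite (bigD1 y) //= lerDl sumr_ge0 // => z _; rewrite exprn_ge0.
Qed.
Lemma ler_expR (x y : R) : x <= y -> exp x <= exp y.
Proof.
rewrite le_eqVlt => /predU1P[-> //|/RltP xy]; apply/ltW/RltP.
exact: exp_increasing.
Qed.

(** The heaviest fibre alone contributes at least [exp (t * (1 + x)) / 2 ^ m], and
    [t * x = m * ln 2] cancels the denominator. *)
Lemma potential_ge_exp (x t : R) (m u : nat) (S : {set 'cV['F_2]_u})
    (A : 'M['F_2]_(m, u)) :
  0 <= x -> t * x = m%:R * ln 2 -> t <= (maxload S A)%:R ->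
  exp t <= potential (exp (1 + x)) S A.
Proof.
move=> x0 tx tM; have exp_ge0 y : 0 <= exp y by apply/RleP/Rlt_le/exp_pos.
apply: le_trans (maxload_potential_le S A (exp_ge0 _)).
have E2 : 2 = exp (ln 2) :> R.
  by apply/esym/exp_ln/RltP; rewrite (ltr0n R 2).
rewrite ler_pdivlMr ?exprn_gt0 // {1}E2 !expRX expRD ler_expR //.
rewrite -[leRHS]mulr_natl RplusE.
have -> : t + ln 2 *+ m = t * (1 + x) by rewrite mulrDr mulr1 tx mulr_natl.
by apply: ler_wpM2r => //; apply: addr_ge0.
Qed.

Lemma maxload_tail (x t : R) (m u : nat) (S : {set 'cV['F_2]_u}) :
  0 <= x -> 0 < t -> t * x = m%:R * ln 2 -> #|S| = expn 2 m ->
  prob_lin (fun A : 'M_(m, u) => Rleb t (INR (maxload S A)))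
  <= 4 * (exp (1 + x) / t) ^+ 2.
Proof.
move=> x0 t0 tx Sm; have b1 : 1 <= exp (1 + x).
  by apply: le_trans (expR_ge1D _); rewrite lerDl; apply: addr_ge0.
rewrite prob_linE; apply: le_trans (avg_potential_tail b1 t0 Sm).
apply: ler_avg => A; rewrite /Rleb; case: Rle_dec => //= /RleP.
by rewrite INRE => /(potential_ge_exp x0 tx) ->.
Qed.

Lemma IZR4E : IZR 4 = 4%:R.
Proof. by rewrite IZRposE INRE. Qed.

Close Scope ring_scope.
Delimit Scope R_scope with R.

Theorem theorem3p6 :
  exists (C D : R), (0 < C)%R /\ (0 < D)%R /\
  exists l0 : nat,
  forall (l u : nat), (l <= u)%N -> (l0 <= l)%N ->
  forall S : {set 'cV['F_2]_u}, #|S| = expn 2 l ->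
  forall Rr : R, (1 < Rr)%R ->
    (Rr * Rpower (INR l) (1 - 1 / Rr) >= D * ln (INR l))%R ->
    (prob_lin (fun A : 'M['F_2]_(l, u) =>
        Rleb (Rr * INR l / log2 (INR l)) (INR (maxload S A)))
     <= C * (ln (INR l)) ^ 2 / (Rr ^ 2 * Rpower (INR l) (2 - 2 / Rr)))%R.
Proof.
(* The factor 4 is that of the tail bound, [exp 1] comes from [b = e * l^(1/R)], and [ln 2] from the
   binary logarithm in the threshold. *)
exists (4 * (exp 1 / ln 2) ^ 2)%R, 1%R.
split; first exact: exp1_div_ln2_sqr_gt0.
split; first exact: Rlt_0_1.
(* From 2 on, [ln l] is positive, and so is the threshold. *)
exists 2%N => l u _ l2 S Sl r r1 _.
have r0 : (0 < r)%R := Rlt_trans _ _ _ Rlt_0_1 r1.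
have l1 : (1 < INR l)%R by apply: (lt_INR 1); apply/ssrnat.ltP.
rewrite tail_boundE // RmultE RpowE RdivE IZR4E.
apply/RleP; apply: maxload_tail => //.
- exact/RleP/Rlt_le/Rdiv_lt_0_compat/r0/ln_gt0.
- exact/RltP/threshold_gt0.
- by rewrite -INRE; apply: threshold_mul_ln.
Qed.
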